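(* ($S$-invariance theorem) All tautological equations are invariant under the action of lower triangular subgroups of the twisted loop groups. That is: let $E=0$ be a tautological equation on $\overline{M}_{g,n}$ and let $\tilde E=0$ be the induced equation of axiomatic Gromov--Witten invariants. Let $\tau=\exp(\sum_{g\ge0}\hbar^{g-1}G_g)$ be the $\tau$-function of a semisimple axiomatic theory for which $\tilde E=0$ holds (for all choices of indices at the external legs). Then for every $s(z^{-1})=\sum_{l\ge1}s_lz^{-l}$ with $s_l\in\operatorname{End}(H)$ and $s^*(-z^{-1})+s(z^{-1})=0$, one has $\hat s(\tilde E)=\frac{d}{d\epsilon_s}\tilde E=0$.
   Context: Setting. $H$ is an $N$-dimensional vector space with a nondegenerate symmetric bilinear form and a distinguished element $\mathbf 1$. Scalars are extended if necessary so that there is an orthonormal basis $\{\phi_i\}$; indices $i,j,\mu$ refer to it, and repeated indices are summed. $^*$ denotes the adjoint. Coordinates $t^i_k$ ($k\ge0$) are dual to $\phi_i z^k\in H[z]$. They are related to coordinates $q^i_k$ by the dilaton shift $t(z)=q(z)+\mathbf 1z$, where $q(z)=\sum q^i_k\phi_iz^k$. On $\mathcal H=H[z,z^{-1}]$ (suitably completed) let $\Omega(f,g)=\operatorname{Res}_{z=0}\langle f(-z),g(z)\rangle$, with Darboux coordinates $p,q$ given by $\sum_k p_k(-z)^{-k-1}+\sum_k q_kz^k$. An infinitesimal symplectic $A(z)$ has quadratic Hamiltonian $\frac12\Omega(Af,f)$, quantized by $q^i_kq^j_l\mapsto q^i_kq^j_l/\hbar$, $p^i_kq^j_l\mapsto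 q^j_l\partial_{q^i_k}$, $p^i_kp^j_l\mapsto\hbar\,\partial_{q^i_k}\partial_{q^j_l}$. The result is $\hat A$, and $\widehat{e^A}:=e^{\hat A}$. The twisted loop group consists of $\operatorname{End}(H)$-valued Laurent series $M(z)$ with $M^*(-z)M(z)=\mathbf I$. Its lower triangular subgroup consists of the elements $S(z^{-1})=e^{s(z^{-1})}$ with $s^*(-z^{-1})+s(z^{-1})=0$. Semisimple axiomatic theories. A genus zero theory is a formal function $G_0(t)$ satisfying the string and dilaton equations and the genus zero topological recursion relations. A semisimple one, $T$, of rank $N$ is obtained from the theory of $N$ points (the sum of $N$ copies of the theory of a point) by an element $S^T(z^{-1})R^T(z)$ of the twisted loop group. Its $\tau$-function is $\tau^T=\widehat{S^T}(\widehat{R^T}\tau^{N\mathrm{pt}})$, where $\tau^{N\mathrm{pt}}=\exp(\sum_g\hbar^{g-1}F_g^{N\mathrm{pt}})$ is the generating function of all Gromov--Witten invariants of $N$ points. The potentials $G_g$ are defined by $\tau^T=\exp(\sum_{g\ge0}\hbar^{g-1}G_g)$. The axiomatic Gromov--Witten invariants are the functions $\langle\partial^{i_1}_{k_1}\cdots\partial^{i_n}_{k_n}\rangle_g:=\partial^nG_g/\partial t^{i_1}_{k_1}\cdots\partial t^{i_n}_{k_n}$. Tautological and induced equations. A tautological equation $E=\sum_mc_m\Gamma_m=0$ on $\overline{M}_{g,n}$ is a relation $\sum_mc_m[\Gamma_m]=0$ in the tautological ring. Here the $\Gamma_m$ are stable graphs decorated by powers of $\psi$ at half-edges and legs and monomials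 in $\kappa$ at vertices, and $[\Gamma]$ is the pushforward of the decorations under the gluing map. The $\kappa$-monomials are removed as follows. Writing $\pi$ for the map forgetting the last $p$ points, invert $$\pi_*(\prod_{b\le n'}\psi_b^{k_b}\prod_{c=1}^p\psi_{n'+c}^{a_c+1})=\Big(\sum_{\sigma\in S_p}\ \prod_{\text{cycles }\gamma\text{ of }\sigma}\kappa_{\sum_{c\in\gamma}a_c}\Big)\prod_{b\le n'}\psi_b^{k_b}.$$ Each vertex decoration is thereby expressed through extra legs decorated by $\psi^{a+1}$, and each such extra leg receives the insertion $\mathbf 1$. The induced expression $\tilde E$ is then obtained as follows. Attach arbitrary fixed indices to the $n$ external legs, and attach to the two halves of each edge a common index $\mu$, which is summed over. Replace each vertex of genus $g_v$ by the correlator $\langle\prod_h\partial^{i_h}_{0,\overline{a_h}}\rangle_{g_v}$ over its half-edges $h$ with decoration $\psi_h^{a_h}$, and multiply over vertices. The ancestor insertions are given, multilinearly inside correlators (with coefficient functions not differentiated), by $\partial^i_{k,\overline0}=\partial^i_k$ and $$\partial^i_{k,\overline l}=\partial^i_{k+1,\overline{l-1}}-\sum_\mu\langle\partial^i_k\partial^\mu_0\rangle_0\,\partial^\mu_{0,\overline{l-1}}.$$ The action. Explicitly $$\hat s=\sum_{l\ge1}\sum_{n\ge0}(s_l)_{ij}q^j_{l+n}\partial_{q^i_n}+\frac1{2\hbar}\sum_{l\ge1}\sum_{n=0}^{l-1}(-1)^n(s_l)_{ij}q^i_nq^j_{l-n-1}.$$ Set $\sum_g\hbar^{g-1}\frac{dG_g}{d\epsilon_s}:=\tau^{-1}\hat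 s\tau$ and $\frac{d}{d\epsilon_s}\langle\partial^{i_1}_{k_1}\cdots\rangle_g:=\partial_{t^{i_1}_{k_1}}\cdots\frac{dG_g}{d\epsilon_s}$, and extend to polynomials in correlators by the Leibniz rule; this defines $\hat s(\tilde E)=\frac{d}{d\epsilon_s}\tilde E$. *)

(* Defs.v *)
From HB Require Import structures.
From mathcomp Require Import all_boot all_order all_fingroup all_algebra.
From mathcomp Require Import boolp classical_sets functions cardinality fsbigop.
Set Implicit Arguments.
Unset Strict Implicit.
Unset Printing Implicit Defensive.
Import GRing.Theory.
Local Open Scope ring_scope.

(** * Stable graphs *)

(* Graphs with legs labelled by 'I_n.  The half-edges are the two ends
   (e, false), (e, true) of every edge e, together with the legs. *)
Record sgraph (n : nat) := SGraph {
  nv : nat;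
  ne : nat;
  vgen : 'I_nv -> nat;
  vat : ('I_ne * bool + 'I_n)%type -> 'I_nv
}.

Section Graphs.
Variables (n : nat) (X : sgraph n).

Definition half : finType := ('I_(ne X) * bool + 'I_n)%type.

Definition at_vertex (v : 'I_(nv X)) : pred half := [pred h | vat h == v].

Definition valence (v : 'I_(nv X)) : nat := #|at_vertex v|.

Definition adjacent : rel 'I_(nv X) := fun v w =>
  [exists e : 'I_(ne X), exists c : bool,
    (vat (inl (e, c)) == v) && (vat (inl (e, ~~ c)) == w)].

(* [b_1 + \sum_v g_v = g] reads [\sum_v g_v + ne + 1 = g + nv] for a connected
   graph. *)
Definition stable_of_genus (g : nat) : Prop :=
  [/\ (0 < nv X)%N,
      forall v w, connect adjacent v w,
      ((\sum_(v < nv X) vgen v) + ne X + 1 = g + nv X)%N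
    & forall v : 'I_(nv X), (2 < 2 * vgen v + valence v)%N].

End Graphs.

(* [vkap v] lists the subscripts of the kappa-monomial sitting at v. *)
Record dgraph (n : nat) := DGraph {
  sg :> sgraph n;
  hpsi : half sg -> nat;
  vkap : 'I_(nv sg) -> seq nat
}.

(** * Intersection theory of the moduli spaces of stable curves *)

(* The moduli spaces are not constructed; their intersection theory enters as a
   structure with the standard axioms below.  The intended instance is
   [coh g n] = A^*(Mbar_{g,n}; Q) (or even cohomology), with [pull], [push] the
   operations for the map forgetting the last point, [relab] the
   relabelling of the points, [glue g X] the pushforward of an exterior product
   along the gluing map of X, and [integ] the degree. Only the values at
   stable (g,n), and at X stable of genus g, are meaningful; a point of the
   curve of vertex v is labelled by the rank of the corresponding half-edge in
   the enumeration of [at_vertex v]. *)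
Record moduli_data := ModuliData {
  coh : nat -> nat -> comAlgType rat;
  psi : forall g n, 'I_n -> coh g n;
  pull : forall g n, {rmorphism coh g n -> coh g n.+1};
  push : forall g n, {linear coh g n.+1 -> coh g n};
  relab : forall g n, {perm 'I_n} -> {rmorphism coh g n -> coh g n};
  glue : forall g n (X : sgraph n),
    (forall v : 'I_(nv X), coh (vgen v) (valence v)) -> coh g n;
  integ : forall g n, {linear coh g n -> rat^o}
}.

Section Moduli.
Variable M : moduli_data.

(* The Arbarello-Cornalba classes. *)
Definition kappa g n (a : nat) : coh M g n :=
  push M g n (psi M g (@ord_max n) ^+ a.+1).

(* Pushforward under the map forgetting the points with labels n, ..., p + n - 1. *)
Fixpoint push_many g n p : coh M g (p + n) -> coh M g n :=
  match p with
  | 0 => id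
  | p'.+1 => fun x => @push_many g n p' (push M g (p' + n) x)
  end.

Definition psi_monomial g n (k : nat -> nat) : coh M g n :=
  \prod_(i < n) psi M g i ^+ k i.

Record moduli_axioms : Prop := ModuliAxioms {
  push_pull : forall g n (a : coh M g n) (b : coh M g n.+1),
    (2 < 2 * g + n)%N -> push M g n (pull M g n a * b) = a * push M g n b;
  psi_pull : forall g n (i : 'I_n), (2 < 2 * g + n)%N ->
    psi M g (widen_ord (leqnSn n) i) * psi M g ord_max
    = pull M g n (psi M g i) * psi M g ord_max;
  string_push : forall g n (k : nat -> nat),
    (2 < 2 * g + n)%N -> k n = 0%N ->
    push M g n (psi_monomial g n.+1 k)
    = \sum_(j < n | (0 < k j)%N)
        psi_monomial g n (fun b => (k b - (b == j))%N);
  kappa_push : forall g n p (k : nat -> nat) (a : 'I_p -> nat),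
    (2 < 2 * g + n)%N ->
    push_many (psi_monomial g (p + n) (fun i => if (i < n)%N then k i
       else if insub (i - n)%N is Some c then (a c).+1 else 0%N))
    = (\sum_(t : {perm 'I_p}) \prod_(C in porbits t)
         kappa g n (\sum_(c in C) a c)%N) * psi_monomial g n k;
  kappa_zero : forall g n, (2 < 2 * g + n)%N ->
    kappa g n 0 = (2 * g + n - 2)%:R;
  relab_psi : forall g n (t : {perm 'I_n}) i,
    relab M g t (psi M g i) = psi M g (t i);
  glue_multilinear : forall g n (X : sgraph n) v (c : rat)
      (x y z : forall v : 'I_(nv X), coh M (vgen v) (valence v)),
    stable_of_genus X g ->
    (forall w, w != v -> x w = y w /\ x w = z w) -> x v = c *: y v + z v ->
    glue g x = c *: glue g y + glue g z;
  integ_relab : forall g n (t : {perm 'I_n}) a,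
    integ M g n (relab M g t a) = integ M g n a;
  integ_push : forall g n a, (2 < 2 * g + n)%N ->
    integ M g n (push M g n a) = integ M g n.+1 a;
  integ_degree : forall g n (k : nat -> nat),
    (2 < 2 * g + n)%N -> (\sum_(i < n) k i + 3 <> 3 * g + n)%N ->
    integ M g n (psi_monomial g n k) = 0;
  integ_glue : forall g n (X : sgraph n)
      (x : forall v : 'I_(nv X), coh M (vgen v) (valence v)),
    stable_of_genus X g ->
    integ M g n (glue g x) = \prod_v (integ M (vgen v) (valence v) (x v) : rat);
  integ_03 : integ M 0 3 1 = 1;
  integ_11 : integ M 1 1 (psi M 1 ord0) = 24%:R^-1
}.

Definition vertex_class n (X : dgraph n) (v : 'I_(nv X)) :
    coh M (vgen v) (valence v) :=
  (\prod_(j < valence v)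
     psi M (vgen v) j ^+ hpsi (@enum_val _ (at_vertex v) j))
  * \prod_(a <- vkap v) kappa (vgen v) (valence v) a.

Definition graph_class g n (X : dgraph n) : coh M g n :=
  glue g (fun v => @vertex_class n X v).

Definition tautological_equation g n m (c : 'I_m -> rat)
    (X : 'I_m -> dgraph n) : Prop :=
  (forall i, stable_of_genus (X i) g) /\
  \sum_(i < m) c i *: graph_class g (X i) = 0.

(* The intersection numbers of psi-classes, i.e. the Gromov-Witten invariants
   of a point. *)
Definition psi_number (g : nat) (k : seq nat) : rat :=
  if (2 < 2 * g + size k)%N
  then integ M g (size k) (psi_monomial g (size k) (nth 0%N k)) else 0.

End Moduli.

(** * Formal functions *)

(* (i, k) is the index of the coordinates [t^i_k] and [q^i_k] and of
   [\partial^i_k]. *)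
Definition idx (N : nat) := ('I_N * nat)%type.

(* A formal function near a point b, represented by its Taylor coefficients:
   the value at [:: a_1; ...; a_m] is [\partial_{a_1} ... \partial_{a_m} f] at b
   (hence the symmetry condition). *)
Definition fps (N : nat) (R : Type) := seq (idx N) -> R.

Definition fsymmetric N R (f : fps N R) : Prop :=
  forall x y, perm_eq x y -> f x = f y.

Section Formal.
Variables (N : nat) (R : comUnitRingType).
Implicit Types (f h : fps N R) (a : idx N).

Definition fder a f : fps N R := fun x => f (a :: x).

(* Taylor coefficients of a product, by the Leibniz rule. *)
Fixpoint fmul f h (x : seq (idx N)) {struct x} : R :=
  if x is a :: x' then fmul (fder a f) h x' + fmul f (fder a h) x'
  else f [::] * h [::].

Definition fconst (c : R) : fps N R := fun x => if x is [::] then c else 0.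

(* The base point of a germ, given by its q-coordinates. *)
Definition qpoint := idx N -> R.

(* The coordinate function [q_a], as a germ at b. *)
Definition qcoord (b : qpoint) a : fps N R := fun x =>
  match x with
  | [::] => b a
  | [:: a'] => (a' == a)%:R
  | _ => 0
  end.

(* [G g] is the genus g potential; it stands for
   [tau = exp (\sum_g hbar^(g-1) G g)]. *)
Definition potentials := nat -> fps N R.

(* For a quantized quadratic monomial A, the coefficients of [hbar^(g-1)] in
   [tau^-1 * (A tau)]: A is [q_a q_c / hbar], [q_a \partial_c],
   [hbar \partial_a \partial_c] respectively. *)
Definition quant_qq (b : qpoint) a c : potentials := fun g =>
  if g == 0%N then fmul (qcoord b a) (qcoord b c) else fun=> 0.

Definition quant_qp (b : qpoint) (G : potentials) a c : potentials := fun g =>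
  fmul (qcoord b a) (fder c (G g)).

Definition quant_pp (G : potentials) a c : potentials := fun g x =>
  (if g is g'.+1 then fder a (fder c (G g')) x else 0)
  + \sum_(h < g.+1) fmul (fder a (G h)) (fder c (G (g - h)%N)) x.

(* The entry 0 of the sequences s and r below is ignored. *)

(* [s(z^-1) = \sum_(l >= 1) s_l z^-l] with [s^*(-z^-1) + s(z^-1) = 0]; the
   adjoint is the transpose since the basis is orthonormal. *)
Definition lower_lie (s : nat -> 'M[R]_N) : Prop :=
  forall l, (0 < l)%N -> (-1) ^+ l *: (s l)^T + s l = 0.

(* [r(z) = \sum_(l >= 1) r_l z^l] with [r^*(-z) + r(z) = 0]. *)
Definition upper_lie (r : nat -> 'M[R]_N) : Prop :=
  forall l, (0 < l)%N -> (-1) ^+ l *: (r l)^T + r l = 0.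

(* The infinite sums over [\in] have finitely many nonzero terms for the base
   points and the potentials considered below. *)

(* [tau^-1 * (\hat s tau)]. *)
Definition shat (s : nat -> 'M[R]_N) (b : qpoint) (G : potentials) :
    potentials := fun g x =>
  \sum_(ln \in [set ln : nat * nat | (0 < ln.1)%N]%classic)
     \sum_(i < N) \sum_(j < N)
       s ln.1 i j * quant_qp b G (j, (ln.1 + ln.2)%N) (i, ln.2) g x
  + 2%:R^-1 * \sum_(l \in [set l : nat | (0 < l)%N]%classic)
     \sum_(n < l) \sum_(i < N) \sum_(j < N)
       (-1) ^+ n * s l i j * quant_qq b (i, n : nat) (j, (l - n - 1)%N) g x.

(* [tau^-1 * (\hat r tau)], with the same sign convention as [\hat s], that is,
   the quantization of [Omega(f, r f) / 2]:
   [\sum (r_l)_ij q^j_n \partial_{q^i_(l+n)}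
    + hbar/2 \sum (-1)^(m+1) (r_l)_ij
        \partial_{q^i_(l-1-m)} \partial_{q^j_m}]. *)
Definition rhat (r : nat -> 'M[R]_N) (b : qpoint) (G : potentials) :
    potentials := fun g x =>
  \sum_(ln \in [set ln : nat * nat | (0 < ln.1)%N]%classic)
     \sum_(i < N) \sum_(j < N)
       r ln.1 i j * quant_qp b G (j, ln.2) (i, (ln.1 + ln.2)%N) g x
  + 2%:R^-1 * \sum_(l \in [set l : nat | (0 < l)%N]%classic)
     \sum_(m < l) \sum_(i < N) \sum_(j < N)
       (-1) ^+ m.+1 * r l i j * quant_pp G (i, (l - m - 1)%N) (j, m : nat) g x.

(* Velocities of the points q moving by [q' = - (s q)_+] and [q' = - r q]. *)
Definition svelocity (s : nat -> 'M[R]_N) (b : qpoint) : qpoint := fun a =>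
  - \sum_(l \in [set l : nat | (0 < l)%N]%classic)
      \sum_(j < N) s l a.1 j * b (j, (l + a.2)%N).

Definition rvelocity (r : nat -> 'M[R]_N) (b : qpoint) : qpoint := fun a =>
  - \sum_(1 <= l < a.2.+1) \sum_(j < N) r l a.1 j * b (j, (a.2 - l)%N).

Definition polynomial_point (b : qpoint) : Prop :=
  exists d, forall i k, (d <= k)%N -> b (i, k) = 0.

(* The vanishing, at points with [q_0 = 0], that holds for the intersection
   numbers of psi-classes because [dim Mbar_{g,n} = 3g - 3 + n]. *)
Definition tame (G : potentials) : Prop :=
  forall g (x : seq (idx N)),
    (3 * g + size x < \sum_(a <- x) a.2 + 3)%N -> G g x = 0.

End Formal.

(** * The quantized group action *)

Section Action.
Variables (K : fieldType) (N : nat).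

(* A one-parameter family of germs, whose base points and Taylor coefficients
   are polynomials in the parameter e, joins (b0, G0) at e = 0 to
   (b1, G1) at e = 1, moves the base points with velocity vel, and solves
   [d tau/de = \hat A tau]; here A b G is [tau^-1 * (\hat A tau)]. The
   second sum is the effect of moving the base point. *)
Definition integrates
    (A : qpoint N {poly K} -> potentials N {poly K} -> potentials N {poly K})
    (vel : qpoint N {poly K} -> qpoint N {poly K})
    (good : qpoint N {poly K} -> potentials N {poly K} -> Prop)
    (b0 : qpoint N K) (G0 : potentials N K)
    (b1 : qpoint N K) (G1 : potentials N K) : Prop :=
  exists (b : qpoint N {poly K}) (G : potentials N {poly K}),
    [/\ good b G /\ (forall g, fsymmetric (G g)),
        forall a, (b a)^`() = vel b a,
        forall g x, (G g x)^`() = A b G g x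
          + \sum_(a \in [set: idx N]%classic) (b a)^`() * G g (a :: x),
        (forall a, (b a).[0] = b0 a) /\ (forall g x, (G g x).[0] = G0 g x)
      & (forall a, (b a).[1] = b1 a) /\ (forall g x, (G g x).[1] = G1 g x)].

Definition poly_family (s : nat -> 'M[K]_N) : nat -> 'M[{poly K}]_N :=
  fun l => map_mx polyC (s l).

(* [tau_1 = \hat S tau_0] for [S = exp (s(z^-1))].  A germ at q0 is carried to
   a germ at the point q with [(S q)_+ = q0]; with these moving base points no
   convergence is needed, all coefficients being polynomial in e. *)
Definition lower_action (s : nat -> 'M[K]_N) :=
  integrates (shat (poly_family s)) (svelocity (poly_family s))
    (fun b _ => polynomial_point b).

(* [tau_1 = \hat R tau_0] for [R = exp (r(z))]. *)
Definition upper_action (r : nat -> 'M[K]_N) :=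
  integrates (rhat (poly_family r)) (rvelocity (poly_family r))
    (fun b G => (forall i, b (i, 0%N) = 0) /\ tame G).

(** * Semisimple axiomatic theories *)

Variables (one : 'cV[K]_N) (M : moduli_data).

(* The point t = 0, that is, [q = - 1 z]. *)
Definition dilaton_point : qpoint N K := fun a =>
  if a.2 == 1%N then - one a.1 0 else 0.

(* The genus g correlator with insertions [tau_k], k in ks, of the theory of a
   point, at the point c with [c_0 = 0] and [c_1] nonzero.  The Taylor expansion
   of F_g in t_2, t_3, ... has finitely many terms for dimension reasons; the
   expansion in t_1 is summed up by the dilaton equation, and yields the power
   of [1 - t_1 = - c_1].  The additive constant [- log(- c_1) / 24] of F_1 is
   dropped: it rescales tau only. *)
Definition point_correlator (c : nat -> K) (g : nat) (ks : seq nat) : K :=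
  \sum_(ls \in [set ls : seq nat | all (leq 2) ls]%classic)
    ratr (psi_number M g (ks ++ ls)) * (\prod_(l <- ls) c l)
      / ((size ls)`!)%:R / (- c 1%N) ^+ (2 * g + size ks + size ls - 2).

(* The germ at c of [tau^{N pt}], the N points being placed on the orthonormal
   basis of H formed by the columns of O. *)
Definition points_potential (O : 'M[K]_N) (c : qpoint N K) : potentials N K :=
  fun g x => \sum_(a < N) (\prod_(p <- x) O p.1 a)
    * point_correlator (fun k => \sum_(i < N) O i a * c (i, k)) g
        [seq p.2 | p <- x].

(* The string equation, the dilaton equation and the topological recursion
   relations, in the coordinates q. *)
Definition genus0_theory (b : qpoint N K) (G0 : fps N K) : Prop :=
  [/\ fsymmetric G0,
      forall x, \sum_(a \in [set: idx N]%classic)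
          fmul (qcoord b (a.1, a.2.+1)) (fder a G0) x
        + 2%:R^-1 * \sum_(i < N)
            fmul (qcoord b (i, 0%N)) (qcoord b (i, 0%N)) x = 0,
      forall x, \sum_(a \in [set: idx N]%classic)
          fmul (qcoord b a) (fder a G0) x = 2%:R * G0 x
    & forall i k a1 a2 x,
        fder (i, k.+1) (fder a1 (fder a2 G0)) x
        = \sum_(mu < N) fmul (fder (i, k) (fder (mu, 0%N) G0))
                             (fder (mu, 0%N) (fder a1 (fder a2 G0))) x].

(* [G] is the germ at b of [tau = \hat S (\hat R tau^{N pt})]; the element of
   the twisted loop group is [exp (s(z^-1)) exp (r(z)) O], with O constant and
   orthogonal. *)
Definition semisimple_theory (b : qpoint N K) (G : potentials N K) : Prop :=
  genus0_theory b (G 0%N) /\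
  exists (O : 'M[K]_N) (r s : nat -> 'M[K]_N)
      (c : qpoint N K) (G1 : potentials N K),
    [/\ O^T *m O = 1%:M,
        upper_lie r /\ lower_lie s,
        forall a, \sum_(i < N) O i a * c (i, 1%N) != 0,
        upper_action r c (points_potential O c) dilaton_point G1
      & lower_action s dilaton_point G1 b G].

(** * Induced equations *)

(* Polynomials in the correlators [<\partial_{a_1} ... \partial_{a_m}>_g]. *)
Inductive cpoly :=
  | CConst of K
  | CCorr of nat & seq (idx N)
  | CAdd of cpoly & cpoly
  | CMul of cpoly & cpoly.

Definition csub P Q := CAdd P (CMul (CConst (- 1)) Q).
Definition csum (I : Type) (r : seq I) (F : I -> cpoly) : cpoly :=
  foldr (fun i => CAdd (F i)) (CConst 0) r.
Definition cprod (I : Type) (r : seq I) (F : I -> cpoly) : cpoly :=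
  foldr (fun i => CMul (F i)) (CConst 1) r.

Fixpoint ceval (G : potentials N K) (P : cpoly) : fps N K :=
  match P with
  | CConst c => fconst c
  | CCorr g l => fun x => G g (l ++ x)
  | CAdd P1 P2 => fun x => ceval G P1 x + ceval G P2 x
  | CMul P1 P2 => fmul (ceval G P1) (ceval G P2)
  end.

(* The derivative of [ceval G P] when G varies with derivative dG. *)
Fixpoint cderive (G dG : potentials N K) (P : cpoly) : fps N K :=
  match P with
  | CConst _ => fun=> 0
  | CCorr g l => fun x => dG g (l ++ x)
  | CAdd P1 P2 => fun x => cderive G dG P1 x + cderive G dG P2 x
  | CMul P1 P2 => fun x => fmul (cderive G dG P1) (ceval G P2) x
                           + fmul (ceval G P1) (cderive G dG P2) x
  end.

(* [Phi] evaluated at the ancestor insertion [\partial^i_{k, \bar l}],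
   a = (i, k), where [Phi] is given on the insertions [\partial_a] and extended
   linearly, coefficient functions included. *)
Fixpoint ancestor (l : nat) (a : idx N) (Phi : idx N -> cpoly) : cpoly :=
  if l is l'.+1 then
    csub (ancestor l' (a.1, a.2.+1) Phi)
      (csum (enum 'I_N) (fun mu => CMul (CCorr 0 [:: a; (mu, 0%N)])
                                        (ancestor l' (mu, 0%N) Phi)))
  else Phi a.

(* The correlator of the insertions [\partial^v_{0, \bar l}], (v, l) in ins,
   and [\partial_a], a in done. *)
Fixpoint ancestor_correlator (g : nat) (done : seq (idx N))
    (ins : seq ('cV[K]_N * nat)) : cpoly :=
  if ins is (v, l) :: ins' then
    csum (enum 'I_N) (fun i => CMul (CConst (v i 0))
      (ancestor l (i, 0%N)
         (fun a => ancestor_correlator g (rcons done a) ins')))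
  else CCorr g done.

Definition cycle_sums (a : seq nat) (t : {perm 'I_(size a)}) : seq nat :=
  [seq (\sum_(c in C) nth 0%N a c)%N
  | C : {set 'I_(size a)} <- enum (porbits t)].

(* The solution X of the triangular system
   [F a = \sum_(t : 'S_p) X (cycle_sums a t)], p = size a, solved for the
   term t = 1; the bound m >= size a makes the recursion structural. *)
Fixpoint kappa_invert_rec (F : seq nat -> cpoly) (m : nat) (a : seq nat) :
    cpoly :=
  if m is m'.+1 then
    csub (F a) (csum [seq t <- enum {perm 'I_(size a)} | t != 1%g]
                  (fun t => kappa_invert_rec F m' (cycle_sums t)))
  else F a.

Definition kappa_invert F a := kappa_invert_rec F (size a) a.

Section Induced.
Variables (n : nat) (ind : 'I_n -> 'I_N).

Definition half_index (X : sgraph n) (mu : {ffun 'I_(ne X) -> 'I_N})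
    (h : half X) : 'I_N :=
  match h with inl (e, _) => mu e | inr i => ind i end.

Definition vertex_correlator (X : dgraph n) (mu : {ffun 'I_(ne X) -> 'I_N})
    (v : 'I_(nv X)) : cpoly :=
  kappa_invert
    (fun extra => ancestor_correlator (vgen v) [::]
       ([seq (delta_mx (half_index mu h) 0, hpsi h) | h <- enum (at_vertex v)]
        ++ [seq (one, a.+1) | a <- extra]))
    (vkap v).

Definition induced_graph (X : dgraph n) : cpoly :=
  csum (enum {ffun 'I_(ne X) -> 'I_N}) (fun mu =>
    cprod (enum 'I_(nv X)) (fun v => vertex_correlator mu v)).

Definition induced m (c : 'I_m -> rat) (X : 'I_m -> dgraph n) : cpoly :=
  csum (enum 'I_m) (fun i => CMul (CConst (ratr (c i))) (induced_graph (X i))).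

End Induced.

(* [\hat s (P) = d P / d epsilon_s]. *)
Definition shat_action (s : nat -> 'M[K]_N) (b : qpoint N K)
    (G : potentials N K) (P : cpoly) : fps N K :=
  cderive G (shat s b G) P.

End Action.

(* Main.v *)
Require Import Defs.
From mathcomp Require Import all_boot all_order all_fingroup all_algebra.
From mathcomp Require Import boolp classical_sets fsbigop.
From mathcomp Require Import ring zify.
Set Implicit Arguments.
Unset Strict Implicit.
Unset Printing Implicit Defensive.
Import GRing.Theory.
Local Open Scope ring_scope.

(** The operator [tau^-1 \hat s tau] is the derivative along the linear vector
    field [V = \sum (s_l)_ij q^j_(l+n) \partial_(q^i_n)], here called [drift],
    plus a quadratic form in q that is present in genus 0 only.  If the second
    part and the non-constancy of V could be neglected, every polynomial E in
    the correlators would satisfy [dE/d epsilon_s = V E], and [E = 0] as a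
    formal function would give [dE/d epsilon_s = 0].  The proof shows that this
    is exactly so for the polynomials made of ancestor correlators.

    The [defect] [dE/d epsilon_s - V E] is a derivation, so it is enough to
    compute it on correlators.  There it has two sources.
    - V does not commute with the [\partial_a]: the bracket replaces
      [\partial^j_k] by [\sum_(1 <= l <= k) (s_l)_ij \partial^i_(k-l)]
      ([moves], [drift_cat]).  Insertions with k = 0 are not affected.
    - Third derivatives of the quadratic form vanish, so that it is seen only by
      genus 0 correlators with at most two insertions.  Its second derivatives
      enter through the coefficients [<\partial^j_k \partial^mu_0>_0] in the
      recursive definition of ancestors; by the symplectic condition on s they
      are the entries of [s_(k+1)] ([quadratic_hessian]).

    Passing from [\partial^j_k,bar(l+1)] to [\partial^j_(k+1),bar(l)], the bracket
    acquires one more term, [(s_(k+1))_mu,j \partial^mu_0,bar(l)], and the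
    quadratic form contributes its opposite.  Hence the defect of
    [\partial^j_k,bar(l)] follows the rule of [\partial^j_k], with the bars
    carried along ([defect_ancestor]), and vanishes for k = 0, which is the only
    case present in induced equations.  The genus 0 vertices of a stable graph
    have valence at least 3, so no vertex sees the quadratic form
    directly.  All vertex correlators thus have zero defect, and so do the
    polynomials formed from them.  The infinite sums in V become finite on
    each Taylor coefficient because the base point is polynomial. *)

(** * The Leibniz product of formal functions *)

Section Product.
Variables (N : nat) (R : comUnitRingType).
Implicit Types (f h u : fps N R) (x y : seq (idx N)).

(** The Taylor coefficient of a product at x involves those of the factors at
    subsequences of x only; a truncation valid below x can therefore be made
    inside a product. *)
Lemma fmul_ext f f' h h' x :
  (forall y, {subset y <= x} -> f y = f' y) ->
  (forall y, {subset y <= x} -> h y = h' y) -> fmul f h x = fmul f' h' x.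
Proof.
elim: x f f' h h' => [|a x IHx] f f' h h' ff' hh' /=.
  by rewrite ff' // hh'.
have sub_tl y : {subset y <= x} -> {subset y <= a :: x}.
  by move=> yx c /yx xc; rewrite inE xc orbT.
have sub_cons y : {subset y <= x} -> {subset a :: y <= a :: x}.
  by move=> yx c; rewrite !inE => /orP[-> //|/yx->]; rewrite orbT.
by congr (_ + _); apply: IHx => y yx; rewrite /fder; auto.
Qed.

Lemma fmul_sumr (I : Type) (r : seq I) (c : I -> R) (F : I -> fps N R) f x :
  fmul f (fun y => \sum_(i <- r) c i * F i y) x
  = \sum_(i <- r) c i * fmul f (F i) x.
Proof.
elim: x f F => [|a x IHx] f F /=.
  by rewrite mulr_sumr; apply: eq_bigr => i _; ring.
by rewrite !IHx -big_split /=; apply: eq_bigr => i _; ring.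
Qed.

Lemma fmulC f h x : fmul f h x = fmul h f x.
Proof.
elim: x f h => [|a x IHx] f h /=; first exact: mulrC.
by rewrite addrC !(IHx _ h) !(IHx f).
Qed.

Lemma fmul_suml (I : Type) (r : seq I) (c : I -> R) (F : I -> fps N R) f x :
  fmul (fun y => \sum_(i <- r) c i * F i y) f x
  = \sum_(i <- r) c i * fmul (F i) f x.
Proof. by rewrite fmulC fmul_sumr; apply: eq_bigr => i _; rewrite fmulC. Qed.

Lemma fmulDl f h u x : fmul (fun y => f y + h y) u x = fmul f u x + fmul h u x.
Proof.
elim: x f h u => [|a x IHx] f h u /=; first by rewrite mulrDl.
by rewrite !IHx; ring.
Qed.

Lemma fmulDr f h u x : fmul u (fun y => f y + h y) x = fmul u f x + fmul u h x.
Proof. by rewrite fmulC fmulDl !(fmulC u). Qed.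

Lemma fmulA f h u x : fmul f (fmul h u) x = fmul (fmul f h) u x.
Proof.
elim: x f h u => [|a x IHx] f h u /=; first by rewrite mulrA.
have -> : fder a (fmul h u)
  = (fun y => fmul (fder a h) u y + fmul h (fder a u) y) by [].
have -> : fder a (fmul f h)
  = (fun y => fmul (fder a f) h y + fmul f (fder a h) y) by [].
by rewrite fmulDl fmulDr !IHx; ring.
Qed.

Lemma fmul_fconst c f x : fmul (fconst c) f x = c * f x.
Proof.
elim: x c f => [|a x IHx] c f //=.
have -> : fder a (fconst c) = fconst 0 :> fps N R by apply: funext; case.
by rewrite !IHx mul0r add0r.
Qed.

Lemma fmul_eq0l f h x : (forall y, f y = 0) -> fmul f h x = 0.
Proof.
move=> f0; have -> : f = fconst 0 by apply: funext => y; rewrite f0; case: y.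
by rewrite fmul_fconst mul0r.
Qed.

Lemma fmul_eq0r f h x : (forall y, h y = 0) -> fmul f h x = 0.
Proof. by rewrite fmulC; apply: fmul_eq0l. Qed.

Lemma fmul_qcoord_cons (b : qpoint N R) a f c x :
  fmul (qcoord b a) f (c :: x)
  = (c == a)%:R * f x + fmul (qcoord b a) (fder c f) x.
Proof.
have -> : (c == a)%:R * f x = fmul (fconst (c == a)%:R) f x.
  by rewrite fmul_fconst.
by rewrite /=; congr (fmul _ _ _ + _); apply: funext; case.
Qed.

Lemma fmul_qcoord_eq0 (b : qpoint N R) a f x :
  b a = 0 -> a \notin x -> fmul (qcoord b a) f x = 0.
Proof.
move=> ba0; elim: x f => [|c x IHx] f; first by rewrite /= ba0 mul0r.
rewrite inE negb_or fmul_qcoord_cons => /andP[ac ax].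
by rewrite eq_sym (negbTE ac) mul0r IHx // addr0.
Qed.

End Product.

Local Arguments fmul : simpl never.

(** * The vector field of a lower triangular element *)

Section Drift.
Variables (K : fieldType) (N : nat) (s : nat -> 'M[K]_N) (b : qpoint N K).
Implicit Types (f h : fps N K) (x : seq (idx N)).

(** The derivative of f along the vector field
    [V = \sum (s_l)_ij q^j_(l+n) \partial_(q^i_n)]. *)
Definition drift f : fps N K := fun x =>
  \sum_(ln \in [set ln : nat * nat | (0 < ln.1)%N]%classic)
     \sum_(i < N) \sum_(j < N) s ln.1 i j
       * fmul (qcoord b (j, (ln.1 + ln.2)%N)) (fder (i, ln.2) f) x.

(** The bracket of [\partial_a] with [V], as a list of coefficients and indices:
    the derivative [\partial_(j,k)] of [q^j_(l+n)] is nonzero exactly for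
    [n = k - l], whence [\sum_(1 <= l <= k) (s_l)_ij \partial_(i,k-l)]. *)
Definition moves (a : idx N) : seq (K * idx N) :=
  [seq (s l.+1 i a.1, (i, (a.2 - l.+1)%N)) | l <- iota 0 a.2, i <- enum 'I_N].

Lemma big_moves j k (F : K * idx N -> K) :
  \sum_(m <- moves (j, k)) F m
  = \sum_(l < k) \sum_(i < N) F (s l.+1 i j, (i, (k - l.+1)%N)).
Proof.
rewrite big_allpairs_dep /= -[k in iota 0 k]subn0 big_mkord.
by apply: eq_bigr => l _; rewrite big_enum.
Qed.

Lemma moves0 j : moves (j, 0%N) = [::].
Proof. by []. Qed.

(** The terms for [k + 1] are those for [k], with the second index raised,
    and one new term for [l = k + 1]; the latter is what the quadratic part of
    [\hat s] has to cancel. *)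
Lemma big_movesS j k (F : K * idx N -> K) :
  \sum_(m <- moves (j, k.+1)) F m
  = \sum_(m <- moves (j, k)) F (m.1, (m.2.1, m.2.2.+1))
    + \sum_(i < N) F (s k.+1 i j, (i, 0%N)).
Proof.
rewrite !big_moves big_ord_recr /= subnn; congr (_ + _).
by apply: eq_bigr => l _; rewrite -subSn.
Qed.

Hypothesis b_poly : polynomial_point b.

Definition bounded L x := all (fun a : idx N => a.2 < L)%N x.

(** A product with [q^j_(l+n)] has nonzero coefficient at x only if this
    coordinate is nonzero at b or occurs in x, so the sum over l and n may be cut
    off uniformly in f and in x of bounded indices. *)
Lemma drift_trunc :
  exists L0, forall L x f, (L0 <= L)%N -> bounded L x ->
    drift f x = \sum_(l < L) \sum_(n < L) \sum_(i < N) \sum_(j < N)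
      s l.+1 i j * fmul (qcoord b (j, (l.+1 + n)%N)) (fder (i, n : nat) f) x.
Proof.
have [L0 b0] := b_poly; exists L0 => L x f L0L xL.
pose r := [seq (l.+1, n) | l <- iota 0 L, n <- iota 0 L].
have in_r l n : ((l, n) \in r) = (0 < l)%N && (l <= L)%N && (n < L)%N.
  apply/allpairsP/idP => [[[l' n'] /= []]|].
    by rewrite !mem_iota !add0n => /= l'L n'L [-> ->]; rewrite l'L n'L.
  case: l => [//|l] /= /andP[lL nL].
  by exists (l, n); rewrite !mem_iota !add0n.
rewrite /drift (@fsbigE _ _ _ _ _ r) /=.
- rewrite big_mkcond big_allpairs_dep /= -[L in iota 0 L]subn0 big_mkord.
  apply: eq_bigr => l _; rewrite big_mkord.
  by apply: eq_bigr => n _; rewrite mem_set.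
- by apply: allpairs_uniq; rewrite ?iota_uniq // => -[? ?] [? ?] _ _ [-> ->].
- by move=> [l n] /=; rewrite in_r => /andP[/andP[]].
move=> [l n] /= l0; rewrite in_r l0 /= negb_and -ltnNge -leqNgt => lnL.
have Lln : (L <= l + n)%N.
  by case/orP: lnL => [/ltnW|] Ll; apply: leq_trans Ll _;
    rewrite ?leq_addr ?leq_addl.
apply: big1 => i _; apply: big1 => j _; rewrite fmul_qcoord_eq0 ?mulr0 //.
  by rewrite b0 // (leq_trans L0L).
by apply/negP => /(allP xL) /=; rewrite ltnNge Lln.
Qed.

Lemma bounded_trunc L0 x : exists2 L, (L0 <= L)%N & bounded L x.
Proof.
exists (L0 + \sum_(a <- x) a.2.+1)%N; rewrite ?leq_addr //.
apply/allP => a ax; rewrite (big_rem a) //=.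
by rewrite addnCA leq_addr.
Qed.

Lemma drift_const c x : drift (fconst c) x = 0.
Proof.
apply: fsbig1 => ln _; apply: big1 => i _; apply: big1 => j _.
have -> : fder (i, ln.2) (fconst c) = fconst 0 :> fps N K.
  by apply: funext; case.
by rewrite fmulC fmul_fconst mul0r mulr0.
Qed.

Lemma driftD f h x : drift (fun y => f y + h y) x = drift f x + drift h x.
Proof.
have [L0 trunc] := drift_trunc; have [L L0L xL] := bounded_trunc L0 x.
rewrite !(trunc L) //.
do 4![rewrite -big_split; apply: eq_bigr => ? _ /=].
by rewrite -mulrDr -fmulDr.
Qed.

Lemma driftM f h x :
  drift (fmul f h) x = fmul (drift f) h x + fmul f (drift h) x.
Proof.
have [L0 trunc] := drift_trunc; have [L L0L xL] := bounded_trunc L0 x.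
pose c (t : 'I_L * 'I_L * 'I_N * 'I_N) := s t.1.1.1.+1 t.1.2 t.2.
pose v f (t : 'I_L * 'I_L * 'I_N * 'I_N) :=
  fmul (qcoord b (t.2, (t.1.1.1.+1 + t.1.1.2)%N))
    (fder (t.1.2, t.1.1.2 : nat) f).
have driftE f' y : {subset y <= x} -> drift f' y = \sum_t c t * v f' t y.
  move=> yx; rewrite (trunc L) //; last by apply/allP => a /yx; apply: (allP xL).
  by rewrite !pair_big.
have driftlE : fmul (drift f) h x = fmul (fun y => \sum_t c t * v f t y) h x.
  by apply: fmul_ext => // y; apply: driftE.
have driftrE : fmul f (drift h) x = fmul f (fun y => \sum_t c t * v h t y) x.
  by apply: fmul_ext => // y; apply: driftE.
rewrite driftE // driftlE driftrE fmul_suml fmul_sumr -big_split /=.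
apply: eq_bigr => t _; rewrite -mulrDr; congr (_ * _); rewrite /v.
set q := qcoord b _; set a := (_, _).
have -> : fder a (fmul f h)
  = (fun y => fmul (fder a f) h y + fmul f (fder a h) y) by [].
rewrite fmulDr fmulA; congr (_ + _).
rewrite !fmulA; apply: fmul_ext => // y _; exact: fmulC.
Qed.

Lemma drift_cons f a x : fsymmetric f ->
  drift f (a :: x)
  = drift (fder a f) x + \sum_(m <- moves a) m.1 * f (m.2 :: x).
Proof.
move=> symf.
have [L0 trunc] := drift_trunc; have [L L0L axL] := bounded_trunc L0 (a :: x).
have /andP[aL xL] := axL.
rewrite !(trunc L) //; case: a aL {axL} => j0 k /= kL; rewrite big_moves /=.
have -> : \sum_(l < k) \sum_(i < N) s l.+1 i j0 * f ((i, (k - l.+1)%N) :: x)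
  = \sum_(l < L) \sum_(n < L) \sum_(i < N) \sum_(j < N)
      s l.+1 i j * (((j0, k) == (j, (l.+1 + n)%N))%:R * f ((i, n : nat) :: x)).
  have row (l : 'I_L) : \sum_(n < L) \sum_(i < N) \sum_(j < N)
      s l.+1 i j * (((j0, k) == (j, (l.+1 + n)%N))%:R * f ((i, n : nat) :: x))
    = if (l < k)%N then \sum_(i < N) s l.+1 i j0 * f ((i, (k - l.+1)%N) :: x)
      else 0.
    rewrite exchange_big /=; case: ifPn => [lk|/negbTE lk].
      apply: eq_bigr => i _.
      have nL : (k - l.+1 < L)%N by apply: leq_ltn_trans kL; apply: leq_subr.
      rewrite (bigD1 (Ordinal nL)) //= (bigD1 j0) //= subnKC // eqxx mul1r.
      rewrite !big1 ?addr0 // => [n n_neq|j /negbTE j_neq]; last first.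
        by rewrite xpair_eqE eq_sym j_neq mul0r mulr0.
      apply: big1 => j _; case: eqP => [[_ kE]|_]; last by rewrite mul0r mulr0.
      by case/eqP: n_neq; apply: val_inj; rewrite /= kE addKn.
    apply: big1 => i _; apply: big1 => n _; apply: big1 => j _.
    case: eqP => [[_ kE]|_]; last by rewrite mul0r mulr0.
    by rewrite kE addSn ltnS leq_addr in lk.
  by rewrite (eq_bigr _ (fun l _ => row l)) -big_mkcond (big_ord_widen _
    (fun l => \sum_(i < N) s l.+1 i j0 * f ((i, (k - l.+1)%N) :: x)) (ltnW kL)).
do 4![rewrite -big_split; apply: eq_bigr => ? _ /=].
rewrite fmul_qcoord_cons mulrDr addrC; congr (_ + _); congr (_ * _).
apply: fmul_ext => // y _; apply: (symf [:: _, _ & y] [:: _, _ & y]).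
by apply/permPl; apply: (perm_catCA [:: _] [:: _]).
Qed.

(** The bracket of [V] with a product of [\partial_a]: by the Leibniz rule,
    one factor is replaced at a time. *)
Fixpoint moves_seq (l : seq (idx N)) : seq (K * seq (idx N)) :=
  if l is a :: l' then
    [seq (m.1, m.2 :: l') | m <- moves a]
    ++ [seq (m.1, a :: m.2) | m <- moves_seq l']
  else [::].

Lemma fsymmetric_fder f a : fsymmetric f -> fsymmetric (fder a f).
Proof. by move=> symf x y xy; apply: symf; rewrite perm_cons. Qed.

Lemma drift_cat f l x : fsymmetric f ->
  drift f (l ++ x)
  = drift (fun y => f (l ++ y)) x + \sum_(m <- moves_seq l) m.1 * f (m.2 ++ x).
Proof.
elim: l f => [|a l IHl] f symf /=; first by rewrite big_nil addr0.
rewrite drift_cons // IHl; last exact: fsymmetric_fder.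
by rewrite big_cat !big_map /= -addrA [X in _ + X]addrC.
Qed.

Lemma big_moves_seq_rcons l a (F : K * seq (idx N) -> K) :
  \sum_(m <- moves_seq (rcons l a)) F m
  = \sum_(m <- moves_seq l) F (m.1, rcons m.2 a)
    + \sum_(m <- moves a) F (m.1, rcons l m.2).
Proof.
elim: l F => [|c l IHl] F /=.
  by rewrite cats0 big_map big_nil add0r.
by rewrite !big_cat !big_map IHl /= addrA.
Qed.

(** * The quadratic term *)

(** The part of [tau^-1 \hat s tau] that does not depend on [tau], in genus
    0. *)
Definition quadratic : fps N K := fun x =>
  2%:R^-1 * \sum_(l \in [set l : nat | (0 < l)%N]%classic)
     \sum_(n < l) \sum_(i < N) \sum_(j < N)
       (-1) ^+ n * s l i j
         * fmul (qcoord b (i, n : nat)) (qcoord b (j, (l - n - 1)%N)) x.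

Lemma shat_genus0 (G : potentials N K) x :
  shat s b G 0 x = drift (G 0%N) x + quadratic x.
Proof. by []. Qed.

Lemma shat_genus_pos (G : potentials N K) g x :
  (0 < g)%N -> shat s b G g x = drift (G g) x.
Proof.
rewrite /shat /quant_qq lt0n => /negbTE ->.
rewrite [X in _ * X]fsbig1 ?mulr0 ?addr0 // => l _.
by do 3![apply: big1 => ? _]; rewrite mulr0.
Qed.

Lemma fmul_qcoord2 a c u v x :
  fmul (qcoord b a) (qcoord b c) [:: u, v & x]
  = fconst ((u == a)%:R * (v == c)%:R + (u == c)%:R * (v == a)%:R) x.
Proof.
rewrite fmul_qcoord_cons.
have -> : fder u (qcoord b c) = fconst (u == c)%:R by apply: funext; case.
rewrite fmulC fmul_fconst.
by case: x => [|w x] //=; rewrite !mulr0 addr0.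
Qed.

Lemma quadratic_eq0 x : (2 < size x)%N -> quadratic x = 0.
Proof.
case: x => [|u [|v [|w x]]] // _.
rewrite /quadratic fsbig1 ?mulr0 // => l _.
by do 3![apply: big1 => ? _]; rewrite fmul_qcoord2 mulr0.
Qed.

Hypothesis charK : [pchar K] =i pred0.
Hypothesis s_lower : lower_lie s.

(** The symplectic condition makes the two monomials [q^mu_0 q^j_k] and
    [q^j_k q^mu_0] of the quadratic form, for [n = 0] and [n = k], have equal
    coefficients. *)
Lemma lower_lie_entry k i j : (-1) ^+ k * s k.+1 j i = s k.+1 i j.
Proof.
have /(congr1 (fun A : 'M_N => A i j)) := s_lower (ltn0Sn k).
rewrite !mxE exprS => /eqP; rewrite mulN1r mulNr addrC subr_eq0 => /eqP ->.
by [].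
Qed.

Lemma quadratic_hessian j k mu x :
  quadratic [:: (j, k), (mu, 0%N) & x] = fconst (s k.+1 mu j) x.
Proof.
case: x => [|w x]; last exact: quadratic_eq0.
rewrite /quadratic /= (@fsbigE _ _ _ _ _ [:: k.+1]) //=.
- rewrite big_cons big_nil mem_set // addr0.
  have two_neq0 : 2%:R != 0 :> K by move/pcharf0P: charK => ->.
  apply: (mulfI two_neq0); rewrite mulVKf //.
  pose c (n : 'I_k.+1) i i' : K := (-1) ^+ n * s k.+1 i i'.
  (* The derivatives meet the two factors [q^i_n q^i'_(k-n)] in either order,
     which forces [n = k] in the first case and [n = 0] in the second. *)
  have first_at_last : \sum_(n < k.+1) \sum_(i < N) \sum_(i' < N)
      c n i i' * (((j, k) == (i, n : nat))%:R
                  * ((mu, 0%N) == (i', (k.+1 - n - 1)%N))%:R) = s k.+1 mu j.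
    rewrite (bigD1 ord_max) //= (bigD1 j) //= (bigD1 mu) //= subSnn !eqxx.
    rewrite !mulr1 /c lower_lie_entry.
    rewrite !big1 ?addr0 // => [n n_neq|i i_neq|i' i'_neq].
    + do 2![apply: big1 => ? _]; case: eqP => [[_ kn]|]; last by rewrite mul0r mulr0.
      by case/eqP: n_neq; apply: val_inj.
    + apply: big1 => ? _; case: eqP => [[ji]|]; last by rewrite mul0r mulr0.
      by rewrite ji eqxx in i_neq.
    case: (_ =P _ :> idx N) => [[mui']|]; last by rewrite !mulr0.
    by rewrite mui' eqxx in i'_neq.
  have first_at_0 : \sum_(n < k.+1) \sum_(i < N) \sum_(i' < N)
      c n i i' * (((j, k) == (i', (k.+1 - n - 1)%N))%:R
                  * ((mu, 0%N) == (i, n : nat))%:R) = s k.+1 mu j.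
    rewrite (bigD1 ord0) //= (bigD1 mu) //= (bigD1 j) //= subn0 subn1 /= !eqxx.
    rewrite !mulr1 /c expr0 mul1r.
    rewrite !big1 ?addr0 // => [n n_neq|i i_neq|i' i'_neq].
    + do 2![apply: big1 => ? _].
      case: (_ =P (_, n : nat)) => [[_ n0]|]; last by rewrite !mulr0.
      by case/eqP: n_neq; apply: val_inj.
    + apply: big1 => ? _; case: (_ =P (i, _)) => [[mui]|]; last by rewrite !mulr0.
      by rewrite mui eqxx in i_neq.
    case: eqP => [[ji']|]; last by rewrite mul0r mulr0.
    by rewrite ji' eqxx in i'_neq.
  rewrite -[2%:R]/(1 + 1) mulrDl mul1r -{1}first_at_last -first_at_0.
  do 3![rewrite -big_split; apply: eq_bigr => ? _ /=].
  by rewrite fmul_qcoord2 mulrDr.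
- by move=> l; rewrite /= inE => /eqP ->.
move=> l l0; rewrite inE => l_neq.
do 3![apply: big1 => ? _]; rewrite fmul_qcoord2 /=.
(* A nonzero term has {n, l - n - 1} = {k, 0}, that is, l = k + 1. *)
set n := (X in (_, nat_of_ord X)); have ln := ltn_ord n.
case: eqP => [[_ kn]|_]; case: (_ =P (_, (l - n - 1)%N)) => [[_ n'E]|_];
  case: (_ =P (_, (l - n - 1)%N)) => [[_ kn']|_]; case: eqP => [[_ nE]|_];
  rewrite ?(mul0r, mulr0, addr0) //; by case/eqP: l_neq; lia.
Qed.

(** * The defect of a polynomial in the correlators *)

Variable G : potentials N K.
Hypothesis G_sym : forall g, fsymmetric (G g).

Implicit Types (P Q : cpoly K N).

Lemma ceval_csub P Q x : ceval G (csub P Q) x = ceval G P x - ceval G Q x.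
Proof. by rewrite /= fmul_fconst mulN1r. Qed.

Lemma ceval_csum (I : Type) (r : seq I) (F : I -> cpoly K N) x :
  ceval G (csum r F) x = \sum_(i <- r) ceval G (F i) x.
Proof.
elim: r => [|i r IHr] /=; first by rewrite big_nil; case: x.
by rewrite big_cons -IHr.
Qed.

(** What separates [\hat s] from the vector field [V] on the polynomial P. *)
Definition defect P : fps N K := fun x =>
  cderive G (shat s b G) P x - drift (ceval G P) x.

Lemma defect_const c x : defect (CConst N c) x = 0.
Proof. by rewrite /defect drift_const subr0. Qed.

Lemma defectD P Q x : defect (CAdd P Q) x = defect P x + defect Q x.
Proof. by rewrite /defect driftD //=; ring. Qed.

Lemma defectM P Q x :
  defect (CMul P Q) x
  = fmul (defect P) (ceval G Q) x + fmul (ceval G P) (defect Q) x.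
Proof.
have fmulBl f f' h : fmul (fun y => f y - f' y) h x = fmul f h x - fmul f' h x.
  apply/eqP; rewrite eq_sym subr_eq -fmulDl; apply/eqP.
  by apply: fmul_ext => // y _; rewrite subrK.
rewrite [fmul (ceval G P) _ x]fmulC !fmulBl !(fmulC _ (ceval G P)).
by rewrite /defect driftM //=; ring.
Qed.

Lemma defectZ c P x : defect (CMul (CConst N c) P) x = c * defect P x.
Proof.
rewrite defectM fmul_fconst.
by rewrite fmul_eq0l ?add0r // => y; apply: defect_const.
Qed.

Lemma defectB P Q x : defect (csub P Q) x = defect P x - defect Q x.
Proof. by rewrite defectD defectZ mulN1r. Qed.

Lemma defect_csum (I : Type) (r : seq I) (F : I -> cpoly K N) x :
  defect (csum r F) x = \sum_(i <- r) defect (F i) x.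
Proof.
elim: r => [|i r IHr] /=; first by rewrite big_nil defect_const.
by rewrite defectD IHr big_cons.
Qed.

(** In genus 0, three insertions annihilate the quadratic form, and only the
    brackets of [V] with the insertions remain. *)
Lemma defect_corr g l x : (0 < g)%N || (2 < size l)%N ->
  defect (CCorr K g l) x
  = \sum_(m <- moves_seq l) m.1 * ceval G (CCorr K g m.2) x.
Proof.
move=> gl; have -> : defect (CCorr K g l) x
    = drift (G g) (l ++ x) - drift (fun y => G g (l ++ y)) x.
  rewrite /defect /=; congr (_ - _).
  case: g gl => [|g] gl; last exact: shat_genus_pos.
  rewrite shat_genus0 quadratic_eq0 ?addr0 // size_cat.
  exact: leq_trans gl (leq_addr _ _).
by rewrite drift_cat // addrAC subrr add0r.
Qed.

(** The coefficient functions in the definition of ancestors are the unstable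
    correlators, on which the quadratic form acts.  The bracket with
    [\partial^mu_0] is zero. *)
Lemma defect_propagator a mu x :
  defect (CCorr K 0 [:: a; (mu, 0%N)]) x
  = \sum_(m <- moves a) m.1 * ceval G (CCorr K 0 [:: m.2; (mu, 0%N)]) x
    + fconst (s a.2.+1 mu a.1) x.
Proof.
case: a => j k.
rewrite /defect [cderive _ _ _ _]shat_genus0 quadratic_hessian /=.
rewrite (drift_cat [:: (j, k); (mu, 0%N)]) //= !big_cat !big_map !big_nil /=.
rewrite addr0; ring.
Qed.

(** The bars of an ancestor insertion are transparent for [\hat s].  The sum over
    [ts] is the defect due to the other insertions of the correlator, which the
    recursion on [l] merely transports. *)
Lemma defect_ancestor (I : Type) (ts : seq (K * I)) (F : idx N -> cpoly K N)
    (F' : I -> idx N -> cpoly K N) :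
  (forall a x, defect (F a) x
     = \sum_(t <- ts) t.1 * ceval G (F' t.2 a) x
       + \sum_(m <- moves a) m.1 * ceval G (F m.2) x) ->
  forall l a x, defect (ancestor l a F) x
     = \sum_(t <- ts) t.1 * ceval G (ancestor l a (F' t.2)) x
       + \sum_(m <- moves a) m.1 * ceval G (ancestor l m.2 F) x.
Proof.
move=> defectF; elim=> [//|l IHl] [j k] x.
rewrite [ancestor _ _ _]/= defectB defect_csum IHl big_movesS /=.
(* The last summand comes from the quadratic form; summed over mu it cancels the
   new term of [big_movesS]. *)
have term mu : defect (CMul (CCorr K 0 [:: (j, k); (mu, 0%N)])
                         (ancestor l (mu, 0%N) F)) x
  = \sum_(t <- ts) t.1 * ceval G (CMul (CCorr K 0 [:: (j, k); (mu, 0%N)])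
                                   (ancestor l (mu, 0%N) (F' t.2))) x
    + \sum_(m <- moves (j, k))
        m.1 * ceval G (CMul (CCorr K 0 [:: m.2; (mu, 0%N)])
                         (ancestor l (mu, 0%N) F)) x
    + s k.+1 mu j * ceval G (ancestor l (mu, 0%N) F) x.
  rewrite defectM.
  rewrite (fmul_ext (fun y _ => defect_propagator (j, k) mu y)
    (fun _ _ => erefl _)) fmulDl fmul_suml fmul_fconst.
  rewrite (fmul_ext (fun _ _ => erefl _) (fun y _ => IHl (mu, 0%N) y)).
  rewrite fmulDr fmul_sumr moves0 [X in _ + (_ + X)]fmul_eq0r; last first.
    by move=> y; rewrite big_nil.
  by rewrite addr0 addrC addrA.
under [X in _ - X]eq_bigr do rewrite term.
rewrite !big_enum /=.
under [X in _ = X + _]eq_bigr do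
  rewrite fmul_fconst mulN1r ceval_csum mulrBr big_enum mulr_sumr.
under [X in _ = _ + X]eq_bigr do
  rewrite fmul_fconst mulN1r ceval_csum mulrBr big_enum mulr_sumr.
rewrite !sumrB !big_split /= [in RHS]exchange_big.
rewrite [X in _ = _ + (_ - X)]exchange_big /=.
by ring.
Qed.

(** Only the plain insertions in [done] contribute: each ancestor insertion
    starts from [\partial^i_0], whose bracket with [V] is zero.  In
    particular the defect is zero for a stable vertex, where [done] is empty. *)
Lemma defect_ancestor_correlator g ins done x :
  (0 < g)%N || (2 < size done + size ins)%N ->
  defect (ancestor_correlator g done ins) x
  = \sum_(m <- moves_seq done) m.1 * ceval G (ancestor_correlator g m.2 ins) x.
Proof.
elim: ins done x => [|[v l] ins IHins] done x gdone /=.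
  by apply: defect_corr; rewrite addn0 in gdone.
rewrite defect_csum big_enum /=.
under eq_bigr => i _.
  rewrite defectZ.
  rewrite (@defect_ancestor _ (moves_seq done) _
    (fun d a => ancestor_correlator g (rcons d a) ins)); last first.
    move=> a y; rewrite IHins ?size_rcons ?addSnnS //.
    by rewrite big_moves_seq_rcons.
  rewrite moves0 big_nil addr0 mulr_sumr.
  over.
rewrite exchange_big /=; apply: eq_bigr => m _.
rewrite ceval_csum big_enum mulr_sumr; apply: eq_bigr => i _ /=.
by rewrite fmul_fconst; ring.
Qed.

(** * Induced equations *)

Lemma defect_cprod (I : Type) (r : seq I) (F : I -> cpoly K N) :
  (forall i x, defect (F i) x = 0) -> forall x, defect (Defs.cprod r F) x = 0.
Proof.
move=> F0; elim: r => [|i r IHr] x /=; first exact: defect_const.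
by rewrite defectM fmul_eq0l // fmul_eq0r // addr0.
Qed.

Lemma defect_kappa_invert (F : seq nat -> cpoly K N) :
  (forall a x, defect (F a) x = 0) ->
  forall a x, defect (kappa_invert F a) x = 0.
Proof.
move=> F0 a; rewrite /kappa_invert; move: (size a) => p.
elim: p a => [|p IHp] a x //=.
by rewrite defectB F0 defect_csum big1 ?subr0.
Qed.

Lemma defect_induced_graph (one : 'cV[K]_N) n (ind : 'I_n -> 'I_N) g
    (X : dgraph n) x :
  stable_of_genus X g -> defect (induced_graph one ind X) x = 0.
Proof.
case=> _ _ _ stab; rewrite defect_csum big1_seq // => mu _.
apply: defect_cprod => v y.
apply: defect_kappa_invert => extra {}y.
rewrite defect_ancestor_correlator /=; first by rewrite big_nil.
rewrite add0n size_cat size_map -cardE.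
have := stab v; rewrite /valence; case: (vgen v) => //= stab_v.
by rewrite (leq_trans stab_v) // muln0 add0n leq_addr.
Qed.

End Drift.

(** Both properties hold along the whole one-parameter family that defines the
    action of a lower triangular element, hence at its end. *)
Lemma semisimple_theory_point_sym (K : fieldType) (N : nat) (one : 'cV[K]_N)
    (M : moduli_data) (b : qpoint N K) (G : potentials N K) :
  semisimple_theory one M b G ->
  polynomial_point b /\ (forall g, fsymmetric (G g)).
Proof.
case=> _ [O [r [s [c [G1 [_ _ _ _]]]]]].
case=> be [Ge [[[d be0] Ge_sym] _ _ _ [be1 Ge1]]]; split.
  by exists d => i k dk; rewrite -be1 be0 // horner0.
by move=> g x y xy; rewrite -!Ge1 (Ge_sym g x y xy).
Qed.

Theorem theorem3 (K : fieldType) (charK : [pchar K] =i pred0)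
    (N : nat) (one : 'cV[K]_N)
    (M : moduli_data) (HM : moduli_axioms M)
    (g n : nat) (gn_stable : (2 < 2 * g + n)%N)
    (m : nat) (c : 'I_m -> rat) (X : 'I_m -> dgraph n)
    (E_taut : tautological_equation M g c X)
    (b : qpoint N K) (G : potentials N K)
    (G_theory : semisimple_theory one M b G)
    (E_holds : forall (ind : 'I_n -> 'I_N) (x : seq (idx N)),
       ceval G (induced one ind c X) x = 0)
    (s : nat -> 'M[K]_N) (s_lower : lower_lie s)
    (ind : 'I_n -> 'I_N) (x : seq (idx N)) :
  shat_action s b G (induced one ind c X) x = 0.
Proof.
have [b_poly G_sym] := semisimple_theory_point_sym G_theory.
have -> : shat_action s b G (induced one ind c X) x
    = defect s b G (induced one ind c X) x
      + drift s b (ceval G (induced one ind c X)) x by rewrite subrK.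
have -> : ceval G (induced one ind c X) = fconst 0.
  by apply: funext => y; rewrite E_holds; case: y.
rewrite drift_const addr0 defect_csum // big1 // => i _.
by rewrite defectZ // (defect_induced_graph _ _ _ _ _ _ _ (E_taut.1 i)) ?mulr0.
Qed.
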